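(* Let $A$ be a Leibniz algebra over a field $\mathbb{F}$. The following are equivalent: (i) The algebra $A$ is perfect, i.e. $A=[A,A]$. (ii) For all Leibniz algebras $K$ and $M$ over $\mathbb{F}$ such that $A\unlhd K\unlhd M$, it follows that $A\unlhd M$. (iii) For all Leibniz algebras $K$ over $\mathbb{F}$ with $A\unlhd K$, it follows that $A$ is a characteristic ideal of $K$.
   Context: A (left) Leibniz algebra over a field $\mathbb{F}$ is an $\mathbb{F}$-vector space $A$ (of arbitrary dimension) with a bilinear product $[\ ,\ ]:A\times A\to A$ such that $[x,[y,z]]=[[x,y],z]+[y,[x,z]]$ for all $x,y,z\in A$. The derived subalgebra $A^2=[A,A]$ is the linear span of all products $[x,y]$, $x,y\in A$; $A$ is perfect if $A=[A,A]$. The notation $A\unlhd K$ means that $A$ is (embedded as) a two-sided ideal of the Leibniz algebra $K$, i.e. a linear subspace with product restricted from $K$ such that $[a,k]\in A$ and $[k,a]\in A$ for all $a\in A$, $k\in K$. A derivation of $K$ is a linear map $f:K\to K$ with $f([x,y])=[f(x),y]+[x,f(y)]$ for all $x,y\in K$. An ideal $A$ of $K$ is a characteristic ideal if $f(A)\subseteq A$ for every derivation $f$ of $K$. *)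

(* Defs.v *)
From HB Require Import structures.
From mathcomp Require Import all_boot all_algebra boolp classical_sets.

Set Implicit Arguments.
Unset Strict Implicit.
Unset Printing Implicit Defensive.

Import GRing.Theory.
Local Open Scope ring_scope.
Local Open Scope classical_set_scope.

(* Left Leibniz algebras: left multiplications are derivations. *)
HB.mixin Record isLeibniz (F : fieldType) V of GRing.Lmodule F V := {
  lbr : V -> V -> V;
  lbr_linearl : forall y : V, linear (fun x : V => lbr x y);
  lbr_linearr : forall x : V, linear (lbr x);
  lbr_leibniz : forall x y z : V,
    lbr x (lbr y z) = lbr (lbr x y) z + lbr y (lbr x z)
}.

#[short(type="leibnizType")]
HB.structure Definition Leibniz (F : fieldType) :=
  {V of isLeibniz F V & GRing.Lmodule F V}.

(* The vector spaces may be infinite-dimensional, so the subspaces are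
   arbitrary classical sets rather than elements of {vspace V}. *)
Definition linear_span (F : fieldType) (V : lmodType F) (S : set V) : set V :=
  [set v | exists (n : nat) (c : 'I_n -> F) (s : 'I_n -> V),
     (forall i, S (s i)) /\ v = \sum_(i < n) c i *: s i].

Definition derived (F : fieldType) (A : leibnizType F) : set A :=
  linear_span [set z | exists x y : A, z = lbr x y].
Arguments derived {F} A.

Definition perfect (F : fieldType) (A : leibnizType F) : Prop := [set: A] = derived A.

Definition is_ideal (F : fieldType) (K : leibnizType F) (I : set K) : Prop :=
  submod_closed (mem I) /\
  (forall a k : K, I a -> I (lbr a k) /\ I (lbr k a)).

Definition is_derivation (F : fieldType) (K : leibnizType F) (f : {linear K -> K}) : Prop :=
  forall x y : K, f (lbr x y) = lbr (f x) y + lbr x (f y).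

Definition is_characteristic (F : fieldType) (K : leibnizType F) (I : set K) : Prop :=
  is_ideal I /\
  (forall f : {linear K -> K}, is_derivation f -> f @` I `<=` I).

(* [A] is an ideal of [K], via the embedding [i]. *)
Definition ideal_embedding (F : fieldType) (A K : leibnizType F)
    (i : {linear A -> K}) : Prop :=
  [/\ injective i, {morph i : x y / lbr x y} & is_ideal (range i)].

(* Main.v *)
Require Import Defs.
From HB Require Import structures.
From mathcomp Require Import all_boot all_algebra boolp classical_sets.

Set Implicit Arguments.
Unset Strict Implicit.
Unset Printing Implicit Defensive.

Import GRing.Theory.
Local Open Scope ring_scope.
Local Open Scope classical_set_scope.

(** Perfect implies the two stability properties because, when [A] is an ideal
    of [K] and [f] is a derivation of [K], the Leibniz rule
    [f [x, y] = [f x, y] + [x, f y]] puts [f [x, y]] in [A] for [x, y] in [A],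
    and products span [A].  If [K] is an ideal of [M], the same computation
    applies to the left multiplications of [M]; the right multiplications are
    handled by [[[x, y], m] = [x, [y, m]] - [y, [x, m]]]
    ([perfect_ideal_trans], [perfect_characteristic]).

    Conversely, both stability properties are tested on one example.  Let [B]
    be the vector space [A / [A, A]], let [K = A x B] with [B] central and
    abelian, and let [f (a, b) = (0, a mod [A, A])].  The map [f] kills all
    products of [K] and takes central values, so it is a derivation; it
    preserves [A x 0] only if every [a] is in [A, A].  So [A] is perfect as soon
    as it is characteristic in [K] ([characteristic_perfect]).  Since moreover
    [[f x, y] = - [y, f x]], both sides being zero, [f] becomes the left
    multiplication by [d] in an extension [M = K + F d] of [K], with
    [[d, x] = f x = - [x, d]] ([derext]).  There [K] is an ideal, and if [A] is
    one too then [f] preserves [A] ([ideal_trans_perfect]).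

    Taking the whole quotient [A / [A, A]] as second factor, instead of the
    field with a nonzero functional vanishing on [A, A], avoids extending
    functionals in infinite dimension. *)

(** * Subspaces and spans *)

Section Subspaces.
Variables (F : fieldType) (V : lmodType F).
Implicit Types S : set V.

Lemma submod_set0 S : submod_closed (mem S) -> S 0.
Proof. by case=> S0 _; rewrite -in_setE. Qed.

Lemma submod_setP S c u v :
  submod_closed (mem S) -> S u -> S v -> S (c *: u + v).
Proof.
by case=> _ lS Su Sv; rewrite -in_setE; apply: lS; apply/mem_set.
Qed.

Lemma submod_setD S u v : submod_closed (mem S) -> S u -> S v -> S (u + v).
Proof. by move=> mS Su Sv; rewrite -[u]scale1r; apply: submod_setP. Qed.

Lemma submod_setB S u v : submod_closed (mem S) -> S u -> S v -> S (u - v).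
Proof. by move=> mS Su Sv; rewrite addrC -scaleN1r; apply: submod_setP. Qed.

Lemma sub_linear_span S : S `<=` linear_span S.
Proof.
move=> v Sv; exists 1%N, (fun=> 1), (fun=> v); split=> //.
by rewrite big_ord1 scale1r.
Qed.

Lemma linear_span_submod S : submod_closed (mem (linear_span S)).
Proof.
split=> [|a u v].
  apply/mem_set; exists 0%N, (fun=> 0), (fun=> 0); split; first by case.
  by rewrite big_ord0.
move=> /set_mem[m [c [s [Ss ->]]]] /set_mem[n [d [t [St ->]]]]; apply/mem_set.
exists (m + n)%N.
exists (fun i => match split i with inl j => a * c j | inr k => d k end).
exists (fun i => match split i with inl j => s j | inr k => t k end).
split=> [i|]; first by case: (split i).
rewrite big_split_ord scaler_sumr; congr (_ + _); apply: eq_bigr => i _.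
  by rewrite (unsplitK (inl i)) scalerA.
by rewrite (unsplitK (inr i)).
Qed.

End Subspaces.

Lemma linear_span_image (F : fieldType) (U V : lmodType F) (f : U -> V)
    (S : set U) (T : set V) :
  linear f -> submod_closed (mem T) -> (forall x, S x -> T (f x)) ->
  forall x, linear_span S x -> T (f x).
Proof.
move=> lf mT fST _ [n [c [s [Ss ->]]]].
pose g : {linear U -> V} := HB.pack f (GRing.isLinear.Build _ _ _ _ f lf).
rewrite -[f]/(g : U -> V) linear_sum.
apply: big_ind => [|u v|i _].
- exact: submod_set0.
- exact: submod_setD.
- rewrite linearZ -[X in T X]addr0.
  by apply: submod_setP => //; [exact: (fST (s i)) | exact: submod_set0].
Qed.

Lemma linear_range_submod (F : fieldType) (U V : lmodType F)
    (f : {linear U -> V}) : submod_closed (mem (range f)).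
Proof.
split=> [|a u v]; first by apply/mem_set; exists 0; rewrite ?linear0.
move=> /set_mem[x _ <-] /set_mem[y _ <-]; apply/mem_set.
by exists (a *: x + y); rewrite ?linearP.
Qed.

(** * Perfect algebras are stable ideals *)

Section Perfect.
Variables (F : fieldType) (A : leibnizType F).
Hypothesis perfA : perfect A.

(** All that perfection is used for: a linear condition on the elements of [A]
    need only be checked on products. *)
Lemma perfect_linear_sub (V : lmodType F) (f : A -> V) (S : set V) :
  linear f -> submod_closed (mem S) -> (forall x y, S (f (lbr x y))) ->
  forall a, S (f a).
Proof.
move=> lf mS fS a; apply: (linear_span_image lf mS
  (S := [set z | exists x y : A, z = lbr x y])).
  by move=> _ [x [y ->]].
by have : [set: A] a by []; rewrite perfA.
Qed.

Lemma perfect_characteristic (K : leibnizType F) (i : {linear A -> K}) :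
  ideal_embedding i -> is_characteristic (range i).
Proof.
move=> [_ iM idA]; split=> // f derf _ [_ [a _ <-] <-].
have [mA multA] := idA.
apply: (@perfect_linear_sub _ (f \o i)) => // [|x y]; first exact: linearP.
rewrite [(f \o i) _]/= iM derf; apply: submod_setD => //.
  by apply: (multA (i y) _ _).2; exists y.
by apply: (multA (i x) _ _).1; exists x.
Qed.

(** Only products with an arbitrary [m] in [M] need an argument.  For [x, y] in
    [A], both [[m, [x, y]]] and [[[x, y], m]] expand into products of an element
    of [A] with an element such as [[m, x]], which lies in [K] because [K] is an
    ideal of [M]; such products are in [A] because [A] is an ideal of [K]. *)
Lemma perfect_ideal_trans (K M : leibnizType F)
    (i : {linear A -> K}) (j : {linear K -> M}) :
  ideal_embedding i -> ideal_embedding j -> ideal_embedding (j \o i).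
Proof.
move=> [iI iM [_ multA]] [jI jM [_ multK]].
have mA : submod_closed (mem (range (j \o i))) by exact: linear_range_submod.
have AK a k : range (j \o i) (lbr (j (i a)) (j k)).
  have [b _ eb] := (multA (i a) k (imageT i a)).1.
  by exists b; rewrite //= eb jM.
have KA a k : range (j \o i) (lbr (j k) (j (i a))).
  have [b _ eb] := (multA (i a) k (imageT i a)).2.
  by exists b; rewrite //= eb jM.
split; first exact: inj_comp.
  by move=> x y /=; rewrite iM jM.
split=> // _ m [a _ <-].
have Km k : range j (lbr (j k) m) by apply: (multK _ _ (imageT j k)).1.
have mK k : range j (lbr m (j k)) by apply: (multK _ _ (imageT j k)).2.
split.
- apply: (@perfect_linear_sub _ (fun a => lbr ((j \o i) a) m)) => //.
    by move=> c u v; rewrite linearP lbr_linearl.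
  move=> x y.
  have -> : lbr ((j \o i) (lbr x y)) m =
      lbr (j (i x)) (lbr (j (i y)) m) - lbr (j (i y)) (lbr (j (i x)) m).
    by rewrite [lbr (j (i x)) _]lbr_leibniz /= iM jM addrK.
  have [k _ <-] := Km (i y); have [l _ <-] := Km (i x).
  exact: submod_setB.
- apply: (@perfect_linear_sub _ (fun a => lbr m ((j \o i) a))) => //.
    by move=> c u v; rewrite linearP lbr_linearr.
  move=> x y; rewrite [(j \o i) _]/= iM jM lbr_leibniz.
  have [k _ <-] := mK (i y); have [l _ <-] := mK (i x).
  exact: submod_setD.
Qed.

End Perfect.

(** * Bilinearity of the bracket *)

Section Brackets.
Variables (F : fieldType) (A : leibnizType F).
Implicit Types x y z : A.

(* The bracket as two families of linear maps, so that the lemmas on linear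
   maps compute its values at sums, opposites and multiples. *)
HB.instance Definition _ x :=
  GRing.isLinear.Build F A A _ (lbr x) (lbr_linearr x).

Definition lbr_by y := lbr^~ y : A -> A.
HB.instance Definition _ y :=
  GRing.isLinear.Build F A A _ (lbr_by y) (lbr_linearl y).

Lemma lbr0l x : lbr 0 x = 0.
Proof. exact: (linear0 (lbr_by x)). Qed.

Lemma lbr0r x : lbr x 0 = 0.
Proof. exact: linear0. Qed.

Lemma lbrDl x y z : lbr (x + y) z = lbr x z + lbr y z.
Proof. exact: (linearD (lbr_by z)). Qed.

Lemma lbrNl x y : lbr (- x) y = - lbr x y.
Proof. exact: (linearN (lbr_by y)). Qed.

Lemma lbrZl c x y : lbr (c *: x) y = c *: lbr x y.
Proof. exact: (linearZ_LR (lbr_by y)). Qed.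

Lemma lbrDr x y z : lbr x (y + z) = lbr x y + lbr x z.
Proof. exact: linearD. Qed.

Lemma lbrNr x y : lbr x (- y) = - lbr x y.
Proof. exact: linearN. Qed.

Lemma lbrZr c x y : lbr x (c *: y) = c *: lbr x y.
Proof. exact: linearZ_LR. Qed.

End Brackets.

(** * The quotient of a vector space by a subspace *)

Section QuotientModule.
Variables (F : fieldType) (V : lmodType F) (W : {pred V}).
Hypothesis subW : submod_closed W.
Local Open Scope quotient_scope.

Let W_zmod : zmodClosed V :=
  HB.pack (W : V -> bool)
    (GRing.isZmodClosed.Build V W (GRing.submod_closedB subW)).

(** Built as a quotient of additive groups; closure of [W] under scaling then
    makes the action of [F] on representatives well defined
    ([quotmod_scaleE]). *)
Definition quotmod := Quotient.quot W_zmod.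
HB.instance Definition _ := GRing.Zmodule.on quotmod.

Definition quotmod_pi (x : V) : quotmod := \pi_(Quotient.quot W_zmod) x.

Lemma quotmod_piE x y : quotmod_pi x = quotmod_pi y <-> x - y \in W.
Proof.
by rewrite (Quotient.idealrBE W_zmod); split=> [exy|/eqP//]; apply/eqP.
Qed.

Lemma quotmod_piD x y : quotmod_pi (x + y) = quotmod_pi x + quotmod_pi y.
Proof. exact: (raddfD \pi_(Quotient.quot W_zmod)). Qed.

Definition quotmod_scale (c : F) (q : quotmod) : quotmod :=
  quotmod_pi (c *: repr (q : Quotient.quot W_zmod)).

Lemma quotmod_scaleE c x : quotmod_scale c (quotmod_pi x) = quotmod_pi (c *: x).
Proof.
have [W0 lW] := subW.
apply/quotmod_piE; rewrite -scalerBr -[_ *: _]addr0; apply: lW => //.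
by apply/quotmod_piE; rewrite /quotmod_pi reprK.
Qed.

Lemma quotmod_piP (q : quotmod) : exists x, q = quotmod_pi x.
Proof.
by exists (repr (q : Quotient.quot W_zmod)); rewrite /quotmod_pi reprK.
Qed.

Fact quotmod_scalerA a b q :
  quotmod_scale a (quotmod_scale b q) = quotmod_scale (a * b) q.
Proof. by have [x ->] := quotmod_piP q; rewrite !quotmod_scaleE scalerA. Qed.

Fact quotmod_scale1r : left_id 1 quotmod_scale.
Proof.
by move=> q; have [x ->] := quotmod_piP q; rewrite quotmod_scaleE scale1r.
Qed.

Fact quotmod_scalerDr : right_distributive quotmod_scale +%R.
Proof.
move=> a p q; have [x ->] := quotmod_piP p; have [y ->] := quotmod_piP q.
by rewrite -quotmod_piD !quotmod_scaleE scalerDr quotmod_piD.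
Qed.

Fact quotmod_scalerDl q : {morph quotmod_scale^~ q : a b / a + b}.
Proof.
move=> a b; have [x ->] := quotmod_piP q.
by rewrite !quotmod_scaleE scalerDl quotmod_piD.
Qed.

HB.instance Definition _ := GRing.Zmodule_isLmodule.Build F quotmod
  quotmod_scalerA quotmod_scale1r quotmod_scalerDr quotmod_scalerDl.

Fact quotmod_pi_linear : linear quotmod_pi.
Proof. by move=> c x y; rewrite quotmod_piD -quotmod_scaleE. Qed.

HB.instance Definition _ :=
  GRing.isLinear.Build F V quotmod _ quotmod_pi quotmod_pi_linear.

End QuotientModule.

(** * Adjoining an abelian direct factor *)

Section AbelianExtension.
Variables (F : fieldType) (A : leibnizType F) (B : lmodType F).

Definition abext : Type := (A * B)%type.
HB.instance Definition _ := GRing.Lmodule.on abext.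

Definition abext_lbr (x y : abext) : abext := (lbr x.1 y.1, 0).

Fact abext_linearl y : linear (abext_lbr^~ y).
Proof.
move=> c u v; rewrite /abext_lbr /= lbr_linearl; congr pair.
by rewrite /= scaler0 addr0.
Qed.

Fact abext_linearr x : linear (abext_lbr x).
Proof.
move=> c u v; rewrite /abext_lbr /= lbr_linearr; congr pair.
by rewrite /= scaler0 addr0.
Qed.

Fact abext_leibniz x y z :
  abext_lbr x (abext_lbr y z) =
  abext_lbr (abext_lbr x y) z + abext_lbr y (abext_lbr x z).
Proof. by rewrite /abext_lbr /= lbr_leibniz; congr pair; rewrite /= addr0. Qed.

HB.instance Definition _ :=
  isLeibniz.Build F abext abext_linearl abext_linearr abext_leibniz.

Definition abext_inj (a : A) : abext := (a, 0).

Fact abext_inj_linear : linear abext_inj.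
Proof. by move=> c x y; congr pair; rewrite /= scaler0 addr0. Qed.

HB.instance Definition _ :=
  GRing.isLinear.Build F A abext _ abext_inj abext_inj_linear.

Lemma abext_inj_ideal : ideal_embedding (abext_inj : {linear A -> abext}).
Proof.
split=> [x y [] //|x y //|]; split; first exact: linear_range_submod.
by move=> x y _; split; eexists.
Qed.

Variable phi : {linear A -> B}.

(** A square-zero endomorphism with central values; it is a derivation exactly
    when [phi] vanishes on products, and it moves [A] out of itself unless
    [phi = 0]. *)
Definition shift (x : abext) : abext := (0, phi x.1).

Fact shift_linear : linear shift.
Proof.
by move=> c x y; rewrite /shift linearP; congr pair; rewrite /= scaler0 addr0.
Qed.

HB.instance Definition _ :=
  GRing.isLinear.Build F abext abext _ shift shift_linear.

Lemma shift_lbrl (x y : abext) : lbr (shift x) y = 0.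
Proof. by congr pair; rewrite /= lbr0l. Qed.

Lemma shift_lbrr (x y : abext) : lbr x (shift y) = 0.
Proof. by congr pair; rewrite /= lbr0r. Qed.

Hypothesis phi0 : forall x y, phi (lbr x y) = 0.

Lemma shift_derivation : is_derivation (shift : {linear abext -> abext}).
Proof.
move=> x y; rewrite shift_lbrl shift_lbrr addr0; congr pair; exact: phi0.
Qed.

Lemma shift_range a : range abext_inj (shift (abext_inj a)) -> phi a = 0.
Proof. by case=> b _ [_ ->]. Qed.

End AbelianExtension.

(** * Making a derivation inner *)

Section DerivationExtension.
Variables (F : fieldType) (K : leibnizType F) (f : {linear K -> K}).

(** The space [K + F d] in which [d] acts on the left by [f] and on the right by
    [- f], with [[d, d] = 0].  The Leibniz identity on the triple [d], [k], [l]
    amounts to the Leibniz rule for [f], but the one on the triple [k], [l], [d]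
    requires in addition [[f k, l] = - [l, f k]].  Both proofs are arguments of
    the type so that it carries a canonical algebra structure. *)
Definition derext of is_derivation f
    & (forall x y, lbr (f x) y = - lbr y (f x)) : Type := (K * F^o)%type.

Hypothesis derf : is_derivation f.
Hypothesis skewf : forall x y, lbr (f x) y = - lbr y (f x).
Local Notation M := (derext derf skewf).
HB.instance Definition _ := GRing.Lmodule.on M.

Definition derext_lbr (x y : M) : M :=
  (lbr x.1 y.1 + (x.2 : F) *: f y.1 - (y.2 : F) *: f x.1, 0).

Fact derext_linearl y : linear (derext_lbr^~ y).
Proof.
move=> c u v; rewrite /derext_lbr; congr pair; rewrite /= ?scaler0 ?addr0 //.
rewrite lbr_linearl linearP !scalerBr !scalerDr scalerDl !scalerA [_ * c]mulrC.
by rewrite opprD [X in X + _ = _]addrACA [LHS]addrACA.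
Qed.

Fact derext_linearr x : linear (derext_lbr x).
Proof.
move=> c u v; rewrite /derext_lbr; congr pair; rewrite /= ?scaler0 ?addr0 //.
rewrite lbr_linearr linearP !scalerBr !scalerDr scalerDl !scalerA [_ * c]mulrC.
by rewrite opprD [X in X + _ = _]addrACA [LHS]addrACA.
Qed.

Fact derext_leibniz x y z :
  derext_lbr x (derext_lbr y z) =
  derext_lbr (derext_lbr x y) z + derext_lbr y (derext_lbr x z).
Proof.
case: x y z => [k s] [l t] [m u].
rewrite /derext_lbr; congr pair; rewrite /= ?addr0 //.
have scC (a b : F) (v : K) : a *: (b *: v) = b *: (a *: v)
  by rewrite !scalerA mulrC.
rewrite !scale0r !subr0 !addr0.
rewrite !(lbrDl, lbrNl, lbrZl, lbrDr, lbrNr, lbrZr).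
rewrite !linearD !linearN !linearZ /=.
rewrite !derf lbr_leibniz (skewf k l) (scC s t) (scC s u) (scC t u).
rewrite !(scalerDr, scalerN, opprD, opprK, addrA).
(* Moving to the end the terms of the right-hand side that cancel in pairs:
   [t [f k, m]], [u [l, f k]] and [t u f (f k)]. *)
rewrite [RHS](ACl (1*8*12*5*2*9*13*6*(11*3)*(4*10)*(7*14))) /=.
by rewrite !subrr !addr0.
Qed.

HB.instance Definition _ :=
  isLeibniz.Build F M derext_linearl derext_linearr derext_leibniz.

Definition derext_inj (k : K) : M := (k, 0).

Fact derext_inj_linear : linear derext_inj.
Proof. by move=> c x y; congr pair; rewrite /= scaler0 addr0. Qed.

HB.instance Definition _ :=
  GRing.isLinear.Build F K M _ derext_inj derext_inj_linear.

Definition derext_gen : M := (0, 1).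

Lemma derext_gen_lbr k : lbr derext_gen (derext_inj k) = derext_inj (f k).
Proof. by congr pair; rewrite /= lbr0l add0r scale1r scale0r subr0. Qed.

Lemma derext_inj_ideal : ideal_embedding (derext_inj : {linear K -> M}).
Proof.
split=> [x y [] //|x y|].
  by congr pair; rewrite /= !scale0r addr0 subr0.
split; first exact: linear_range_submod.
by move=> x y _; split; eexists.
Qed.

End DerivationExtension.

(** * The abelianization and the two converse implications *)

Section AbelianizationExtension.
Variables (F : fieldType) (A : leibnizType F).

Definition derivedb : {pred A} := fun x => `[< derived A x >].

Fact derivedb_submod : submod_closed derivedb.
Proof.
have [S0 lS] := linear_span_submod [set z | exists x y : A, z = lbr x y].
split=> [|c u v /asboolP/mem_set Su /asboolP/mem_set Sv].
  exact/asboolP/set_mem.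
exact/asboolP/set_mem/lS.
Qed.

Definition abelianization : {linear A -> quotmod derivedb_submod} :=
  quotmod_pi derivedb_submod.

Lemma abelianization_eq0 x : abelianization x = 0 <-> derived A x.
Proof.
rewrite -[0](linear0 abelianization).
apply: iff_trans (quotmod_piE _ _ _) _.
by rewrite subr0; split => /asboolP.
Qed.

Lemma abelianization_lbr x y : abelianization (lbr x y) = 0.
Proof. by apply/abelianization_eq0/sub_linear_span; exists x, y. Qed.

Lemma abelianization0_perfect : (forall a, abelianization a = 0) -> perfect A.
Proof.
by move=> A0; apply/seteqP; split=> // a _; apply/abelianization_eq0.
Qed.

Let K := abext A (quotmod derivedb_submod).
Let f : {linear K -> K} := shift abelianization.

Fact der_shift : is_derivation f.
Proof. exact/shift_derivation/abelianization_lbr. Qed.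

Fact skew_shift (x y : K) : lbr (f x) y = - lbr y (f x).
Proof. by rewrite shift_lbrl shift_lbrr oppr0. Qed.

Lemma characteristic_perfect :
  (forall (K : leibnizType F) (i : {linear A -> K}),
     ideal_embedding i -> is_characteristic (range i)) -> perfect A.
Proof.
move=> charA; apply: abelianization0_perfect => a.
have [_ charK] := charA _ _ (@abext_inj_ideal F A (quotmod derivedb_submod)).
apply: shift_range; apply: (charK _ der_shift).
by exists (abext_inj _ a) => //; exists a.
Qed.

Lemma ideal_trans_perfect :
  (forall (K M : leibnizType F) (i : {linear A -> K}) (j : {linear K -> M}),
     ideal_embedding i -> ideal_embedding j -> ideal_embedding (j \o i)) ->
  perfect A.
Proof.
move=> transA; apply: abelianization0_perfect => a.
have [injj _ _] := derext_inj_ideal der_shift skew_shift.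
have [_ _ [_ idM]] := transA _ _ _ _
  (@abext_inj_ideal F A (quotmod derivedb_submod))
  (derext_inj_ideal der_shift skew_shift).
have [_] := idM _ (derext_gen der_shift skew_shift) (imageT _ a).
(* If [A] is an ideal of [M], then [[d, a] = f a] lies in [A]. *)
rewrite /= derext_gen_lbr => -[b _ /injj fa].
by apply: shift_range; exists b.
Qed.

End AbelianizationExtension.

Theorem theorem1p1 (F : fieldType) (A : leibnizType F) :
  [<-> perfect A;
       forall (K M : leibnizType F) (i : {linear A -> K}) (j : {linear K -> M}),
         ideal_embedding i -> ideal_embedding j -> ideal_embedding (j \o i);
       forall (K : leibnizType F) (i : {linear A -> K}),
         ideal_embedding i -> is_characteristic (range i)].
Proof.
tfae.
- exact: perfect_ideal_trans.
- by move=> /ideal_trans_perfect; exact: perfect_characteristic.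
- exact: characteristic_perfect.
Qed.
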